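(* Fix $m\in\mathbb{N}$, $m\ge1$, and let $0<p<1$. Let $\mathcal{P}$ be the set of subsets of $\{1,\ldots,m\}$. (i) Consider the random walk on $\mathcal{P}$ in which, starting from $X\in\mathcal{P}$, a subset $Y\subseteq X$ is chosen by putting each $x\in X$ in $Y$ independently with probability $p$, and the walk then steps to $\{1,\ldots,m\}\setminus Y$. This walk is irreducible, reversible, recurrent and ergodic, with unique invariant distribution $\pi$ where $\pi_X=p^{m-|X|}/(1+p)^m$ for each $X\in\mathcal{P}$. Its eigenvalues are $(-p)^e$ for $0\le e\le m$, with multiplicities $\binom{m}{e}$. (ii) Taking two steps at a time in the walk in (i) gives the walk on $\mathcal{P}$ in which each step is a down-step followed by an up-step. This walk has the same invariant distribution, and its eigenvalues are $p^{2e}$ for $0\le e\le m$, again with multiplicities $\binom{m}{e}$.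
   Context: The eigenvalues of a walk are those of its transition matrix. A finite Markov chain with transition matrix $P$ is reversible if it has an invariant distribution $\pi$ with $\pi_XP_{XZ}=\pi_ZP_{ZX}$ for all states $X,Z$; it is ergodic if it is irreducible and aperiodic. A down-step from $X$ moves to the random subset $Y\subseteq X$ in which each element of $X$ is retained independently with probability $p$. An up-step from $Y$ moves to the superset $\{1,\ldots,m\}\setminus W$ of $Y$, where $W$ is obtained by a down-step from $\{1,\ldots,m\}\setminus Y$. *)

(* Defs.v *)
From HB Require Import structures.
From mathcomp Require Import all_boot all_order all_algebra.
From mathcomp Require Import all_classical all_reals all_analysis.

Set Implicit Arguments.
Unset Strict Implicit.
Unset Printing Implicit Defensive.

Import Order.TTheory GRing.Theory Num.Theory.
Import numFieldNormedType.Exports.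

Local Open Scope classical_set_scope.
Local Open Scope ring_scope.

Section MarkovChain.
Context {R : realType} {S : finType}.

(* The matrix of a kernel [k], with rows and columns indexed by the canonical
   enumeration of the state space; [prob P x y] reads off its entries. *)
Definition kernel_mx (k : S -> S -> R) : 'M[R]_#|S| :=
  \matrix_(i, j) k (enum_val i) (enum_val j).

Definition prob (P : 'M[R]_#|S|) (x y : S) : R :=
  P (enum_rank x) (enum_rank y).

Implicit Types (P : 'M[R]_#|S|) (mu : S -> R).

Definition distribution_on mu : Prop :=
  (forall x, 0 <= mu x) /\ \sum_x mu x = 1.

Definition invariant_distribution P mu : Prop :=
  distribution_on mu /\ forall y, \sum_x mu x * prob P x y = mu y.

Definition unique_invariant_distribution P mu : Prop :=
  invariant_distribution P mu /\
  forall nu, invariant_distribution P nu -> nu =1 mu.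

Definition reversible P : Prop :=
  exists2 mu, invariant_distribution P mu &
    forall x z, mu x * prob P x z = mu z * prob P z x.

Definition irreducible_chain P : Prop :=
  forall x y, exists n, 0 < prob (P ^+ n) x y.

(* The greatest common divisor of the positive return times to [x] is 1: no
   [d] other than 1 divides all of them. *)
Definition aperiodic P : Prop :=
  forall (x : S) (d : nat),
    (forall n, (0 < n)%N -> 0 < prob (P ^+ n) x x -> (d %| n)%N) -> d = 1%N.

Definition ergodic P : Prop := irreducible_chain P /\ aperiodic P.

(* The probability that the chain started at [x] is in [y] at time [n.+1], and
   at none of the times 1, ..., n. *)
Fixpoint first_passage P (y : S) (n : nat) (x : S) : R :=
  if n is n'.+1 then
    \sum_(z | z != y) prob P x z * first_passage P y n' z
  else prob P x y.

(* From every state, the chain almost surely returns to that state. *)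
Definition recurrent P : Prop :=
  forall x, series (fun n => first_passage P x n x) @ \oo --> (1 : R).

End MarkovChain.

(* The eigenvalues of [A] are the [lam e] for 0 <= e <= m, and [mult e] is both
   the algebraic and the geometric multiplicity of [lam e]. The characteristic
   polynomial splits over [R], so there are no further complex eigenvalues. *)
Definition eigenvalues_with_mult (R : realType) (k : nat) (A : 'M[R]_k)
    (m : nat) (lam : nat -> R) (mult : nat -> nat) : Prop :=
  [/\ forall a, eigenvalue A a <-> exists2 e, (e <= m)%N & a = lam e,
      char_poly A = \prod_(e < m.+1) ('X - (lam e)%:P) ^+ mult e
    & forall e, (e <= m)%N -> \rank (eigenspace A (lam e)) = mult e].

Section Walks.
Context {R : realType} {m : nat}.
Implicit Types (p : R) (X Y Z W : {set 'I_m}).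

Definition down_prob p X Y : R :=
  if Y \subset X then \prod_(x in X) (if x \in Y then p else 1 - p) else 0.

Definition up_prob p Y Z : R :=
  \sum_(W | ~: W == Z) down_prob p (~: Y) W.

Definition complement_walk_prob p X Z : R :=
  \sum_(Y | ~: Y == Z) down_prob p X Y.

Definition down_step p := kernel_mx (down_prob p).
Definition up_step p := kernel_mx (up_prob p).
Definition complement_walk p := kernel_mx (complement_walk_prob p).

(* Products of transition matrices read left to right in time. *)
Definition down_up_walk p := down_step p *m up_step p.

Definition walk_pi p X : R := p ^+ (m - #|X|) / (1 + p) ^+ m.

End Walks.

(* Main.v *)
Require Import Defs.
From HB Require Import structures.
From mathcomp Require Import all_boot all_order all_algebra.
From mathcomp Require Import all_classical all_reals all_analysis.
From mathcomp Require Import ring.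

Set Implicit Arguments.
Unset Strict Implicit.
Unset Printing Implicit Defensive.

Import Order.TTheory GRing.Theory Num.Theory.
Import numFieldNormedType.Exports.

Local Open Scope classical_set_scope.
Local Open Scope ring_scope.

(* The walk acts on the m coordinates independently, so its matrix is the m-th
   tensor power of the 2x2 matrix with rows (0,1) and (p,1-p), which has the
   eigenvalues 1 and -p; a tensor product of eigenvectors with e factors for -p
   has eigenvalue (-p)^e. Uniqueness of the invariant distribution is the
   one-dimensionality of the eigenspace for 1. Two and three steps join any two
   states with positive probability, which gives irreducibility and
   aperiodicity. *)

(** * Rank and spectrum of diagonalisable matrices *)

Section DiagonalMatrices.
Context {F : fieldType}.

Lemma mxrank_diag_le n (d : 'rV[F]_n) :
  (\rank (diag_mx d) <= #|[pred i | d 0%R i != 0%R]|)%N.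
Proof.
rewrite diag_mx_sum_delta -sum1_card [leqRHS]big_mkcond /=.
apply: (big_rec2 (fun B k => (\rank B <= k)%N)) => [|i B k _ IH]; first by rewrite mxrank0.
apply: leq_trans (mxrank_add _ _) (leq_add _ IH).
rewrite inE; case: ifPn => [nz|]; first by rewrite mxrank_scale_nz // mxrank_delta.
by rewrite negbK => /eqP ->; rewrite scale0r mxrank0.
Qed.

(* The lower bound holds because adding the indicator of the zero entries of
   [d] turns [diag_mx d] into an invertible matrix. *)
Lemma mxrank_diag n (d : 'rV[F]_n) :
  \rank (diag_mx d) = #|[pred i | d 0 i != 0]|.
Proof.
apply/eqP; rewrite eqn_leq mxrank_diag_le /=.
pose d' : 'rV[F]_n := \row_i (d 0 i == 0)%:R.
have full : \rank (diag_mx d + diag_mx d')%R = n.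
  rewrite -linearD mxrank_unit //.
  rewrite unitmxE det_diag unitfE.
  apply/prodf_neq0 => i _; rewrite !mxE.
  by case: (eqVneq (d 0 i) 0) => [->|]; rewrite ?add0r ?oner_eq0 ?addr0.
have := leq_trans (mxrank_add (diag_mx d) (diag_mx d'))
  (leq_add (leqnn _) (mxrank_diag_le d')).
rewrite full -{1}(card_ord n) -(cardC [pred i | d 0 i != 0]).
rewrite (_ : #|[pred i | d' 0 i != 0]| = #|predC [pred i | d 0 i != 0]|).
  by rewrite leq_add2r.
apply: eq_card => i; rewrite !inE mxE negbK.
by case: (d 0 i == 0); rewrite ?oner_eq0 ?eqxx.
Qed.

Section Conjugate.
Context {n : nat} {A U V : 'M[F]_n} {d : 'rV[F]_n}.
Hypotheses (VU : V *m U = 1%:M) (AV : A *m V = V *m diag_mx d).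

Lemma conj_diag_mx : A = V *m diag_mx d *m U.
Proof. by rewrite -AV -mulmxA VU mulmx1. Qed.

(** [V] and [U] stay mutually inverse as matrices of polynomials, so ['X - A] is conjugate to
    ['X - diag_mx d] and has the same determinant. *)
Lemma char_poly_conj_diag : char_poly A = \prod_i ('X - (d 0 i)%:P).
Proof.
have VUp : map_mx polyC V *m map_mx polyC U = 1%:M.
  by rewrite -map_mxM VU map_mx1.
rewrite /char_poly (_ : char_poly_mx A =
  map_mx polyC V *m diag_mx (\row_i ('X - (d 0 i)%:P)) *m map_mx polyC U).
  rewrite !det_mulmx mulrAC -det_mulmx VUp det1 mul1r det_diag.
  by apply: eq_bigr => i _; rewrite mxE.
rewrite (_ : diag_mx _ = 'X%:M - map_mx polyC (diag_mx d)); last first.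
  by apply/matrixP => i j; rewrite !mxE mulrnBl [in RHS]rmorphMn.
rewrite mulmxBr mulmxBl scalar_mxC -[_%:M *m _ *m _]mulmxA VUp mulmx1.
by rewrite /char_poly_mx -!map_mxM -conj_diag_mx.
Qed.

(** Subtracting the scalar [a] is compatible with the conjugation, and the invertible factors [V]
    and [U] do not change the rank. *)
Lemma mxrank_eigenspace_conj_diag a :
  \rank (eigenspace A a) = #|[pred i | d 0 i == a]|.
Proof.
have Vu : V \in unitmx by case: (mulmx1_unit VU).
have Uu : U \in unitmx by case: (mulmx1_unit VU).
rewrite /eigenspace mxrank_ker.
rewrite (_ : A - a%:M = V *m diag_mx (d - const_mx a) *m U); last first.
  rewrite linearB /= diag_const_mx mulmxBr mulmxBl -conj_diag_mx.
  by rewrite scalar_mxC -[_%:M *m _ *m _]mulmxA VU mulmx1.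
rewrite mxrankMfree ?row_free_unit // -mxrank_tr trmx_mul.
rewrite mxrankMfree ?row_free_unit ?unitmx_tr // mxrank_tr mxrank_diag.
rewrite -[X in (X - _)%N](card_ord n) -(cardC [pred i | d 0 i == a]).
rewrite (_ : #|[pred i | _ != 0]| = #|predC [pred i | d 0 i == a]|) ?addnK //.
by apply: eq_card => i; rewrite !inE !mxE subr_eq0.
Qed.

End Conjugate.
End DiagonalMatrices.

(** Column [i] of [V] is an eigenvector for [lam (f i)]; grouping the columns by [f] gives both
    multiplicities. Injectivity of [lam] makes the columns for the value [lam e] those with
    [f i = e]. *)
Lemma eigenvalues_with_mult_conj_diag (R : realType) (k m : nat)
    (A U V : 'M[R]_k) (f : 'I_k -> nat) (lam : nat -> R) (mult : nat -> nat) :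
    V *m U = 1%:M -> A *m V = V *m diag_mx (\row_i lam (f i)) ->
    {in [pred e | (e <= m)%N] &, injective lam} ->
    (forall i, f i <= m)%N ->
    (forall e, (e <= m)%N -> #|[pred i | f i == e]| = mult e) ->
    (forall e, (e <= m)%N -> (0 < mult e)%N) ->
  eigenvalues_with_mult A m lam mult.
Proof.
move=> VU AV lamI fm card_f mult_gt0.
have charE : char_poly A = \prod_(e < m.+1) ('X - (lam e)%:P) ^+ mult e.
  rewrite (char_poly_conj_diag VU AV).
  rewrite (partition_big (fun i => inord (f i) : 'I_m.+1) xpredT) //=.
  apply: eq_bigr => e _; rewrite -(card_f _ (ltn_ord e)) -prodr_const.
  apply: eq_big => [i|i]; rewrite ?inE; last first.
    by move/eqP <-; rewrite mxE inordK ?ltnS.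
  by rewrite -val_eqE /= inordK // ltnS.
split=> // [a|e em].
- rewrite eigenvalue_root_char charE; split.
    rewrite rootE horner_prod prodf_seq_eq0 => /hasP[e _ /=].
    rewrite horner_exp expf_eq0 hornerXsubC subr_eq0 => /andP[_ /eqP ->].
    by exists e => //; rewrite -ltnS.
  case=> e em ->; rewrite -ltnS in em.
  rewrite rootE horner_prod (bigD1 (Ordinal em)) //= horner_exp hornerXsubC.
  by rewrite subrr expr0n eqn0Ngt mult_gt0 ?mul0r.
- rewrite (mxrank_eigenspace_conj_diag VU AV) -card_f //.
  apply: eq_card => i; rewrite !inE mxE.
  by apply/eqP/eqP => [/lamI -> //|-> //]; rewrite inE.
Qed.

(** * Finite chains and their invariant distributions *)

Section FiniteChains.
Context {R : realType} {S : finType}.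
Implicit Types (P : 'M[R]_#|S|) (k l : S -> S -> R) (mu : S -> R).

Lemma sum_enum_val (F : 'I_#|S| -> R) : \sum_i F i = \sum_x F (enum_rank x).
Proof. by rewrite (reindex enum_rank) //; exact/onW_bij/enum_rank_bij. Qed.

Lemma prob_kernel_mx k x y : prob (kernel_mx k) x y = k x y.
Proof. by rewrite /prob mxE !enum_rankK. Qed.

Lemma mul_kernel_mx k l :
  kernel_mx k *m kernel_mx l = kernel_mx (fun x z => \sum_y k x y * l y z).
Proof.
apply/matrixP => i j; rewrite !mxE sum_enum_val.
by apply: eq_bigr => y _; rewrite !mxE enum_rankK.
Qed.

Lemma kernel_mx_id :
  kernel_mx (fun x y : S => (x == y)%:R) = 1%:M :> 'M[R]_#|S|.
Proof. by apply/matrixP => i j; rewrite !mxE (inj_eq enum_val_inj). Qed.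

Lemma eq_kernel_mx k l : k =2 l -> kernel_mx k = kernel_mx l.
Proof. by move=> kl; apply/matrixP => i j; rewrite !mxE kl. Qed.

Definition row_of_fun mu : 'rV[R]_#|S| := \row_i mu (enum_val i).

Lemma invariant_distributionP P mu :
  invariant_distribution P mu <->
  distribution_on mu /\ row_of_fun mu *m P = row_of_fun mu.
Proof.
have rowE x : (row_of_fun mu *m P) 0 (enum_rank x) = \sum_z mu z * prob P z x.
  by rewrite mxE sum_enum_val; apply: eq_bigr => z _; rewrite mxE enum_rankK.
split=> -[dmu inv]; split=> //.
  by apply/rowP => i; rewrite -(enum_valK i) rowE inv mxE enum_rankK.
by move=> y; rewrite -rowE inv mxE enum_rankK.
Qed.

(** Eigenspaces consist of row vectors, so invariant distributions lie in the eigenspace for 1. When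
    this is a line, total mass 1 fixes the scalar. *)
Lemma unique_invariant_distribution_rank1 P mu :
    invariant_distribution P mu -> \rank (eigenspace P 1) = 1%N ->
  unique_invariant_distribution P mu.
Proof.
move=> imu rk1; split=> // nu inu.
have [[_ mu1] /[dup] Emu] := (invariant_distributionP P mu).1 imu.
have [[_ nu1] /[dup] Enu] := (invariant_distributionP P nu).1 inu.
rewrite -{2}[row_of_fun nu]scale1r => /eigenspaceP nu_eig.
rewrite -{2}[row_of_fun mu]scale1r => /eigenspaceP mu_eig.
have mu_neq0 : row_of_fun mu != 0.
  apply: contra_eq_neq mu1 => /rowP mu0; rewrite big1 1?eq_sym ?oner_eq0 // => x _.
  by have := mu0 (enum_rank x); rewrite !mxE enum_rankK.
have := mxrank_leqif_sup mu_eig; rewrite rk1 rank_rV mu_neq0 => -[_ /esym].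
rewrite eqxx => /(submx_trans nu_eig) /sub_rVP[a Ea].
have nuE x : nu x = a * mu x.
  by move/rowP/(_ (enum_rank x)): Ea; rewrite !mxE enum_rankK.
suff a1 : a = 1 by move=> x; rewrite nuE a1 mul1r.
by rewrite -nu1 (eq_bigr _ (fun x _ => nuE x)) -mulr_sumr mu1 mulr1.
Qed.

(** * Recurrence from a positive invariant distribution *)

Section Recurrence.
Context {P : 'M[R]_#|S|} {mu : S -> R}.
Hypotheses (P_ge0 : forall x y, 0 <= prob P x y).
Hypotheses (P_sum1 : forall x, \sum_y prob P x y = 1).
Hypotheses (mu_inv : invariant_distribution P mu) (mu_gt0 : forall x, 0 < mu x).

(** The probability of avoiding [y] at all times 1, ..., n from [x]: index [k] of [first_passage]
    stands for time [k + 1]. *)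
Definition survival (y : S) (n : nat) (x : S) : R :=
  1 - \sum_(0 <= k < n) first_passage P y k x.

Lemma survivalS y n x :
  survival y n.+1 x = \sum_(z | z != y) prob P x z * survival y n z.
Proof.
(* The constant 1 is expanded as a row sum; its term at [y] cancels the passage at index 0. *)
rewrite /survival big_nat_recl //= -[X in X - _](P_sum1 x) (bigD1 y) //=.
rewrite opprD addrACA subrr add0r exchange_big /= -sumrB.
by apply: eq_bigr => z _; rewrite -mulr_sumr mulrBr mulr1.
Qed.

Lemma survival_ge0 y n x : 0 <= survival y n x.
Proof.
elim: n x => [|n IH] x; first by rewrite /survival big_geq // subr0.
by rewrite survivalS sumr_ge0 // => z _; rewrite mulr_ge0.
Qed.

(** By invariance, averaging [survivalS] over [mu] returns the average at time [n] without its term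
    at [y]. *)
Lemma sum_survivalS y n :
  mu y * survival y n y =
  \sum_x mu x * survival y n x - \sum_x mu x * survival y n.+1 x.
Proof.
under [X in _ - X]eq_bigr => x _ do rewrite survivalS mulr_sumr.
rewrite exchange_big /= [X in X - _](bigD1 y) //=.
rewrite [X in _ - X](_ : _ = \sum_(z | z != y) mu z * survival y n z) ?addrK //.
apply: eq_bigr => z _; under eq_bigr => x _ do rewrite mulrA.
by rewrite -mulr_suml mu_inv.2.
Qed.

(* Started from [mu], the masses [mu y * survival y n y] telescope to at most
   1, so they tend to 0. *)
Lemma recurrent_of_invariant : recurrent P.
Proof.
move=> y; pose u n := mu y * survival y n y.
have u_ge0 n : 0 <= u n by rewrite mulr_ge0 ?survival_ge0 // ltW.
have uE n : series u n = 1 - \sum_x mu x * survival y n x.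
  rewrite /series /= (eq_bigr (fun j => - (\sum_x mu x * survival y j.+1 x -
    \sum_x mu x * survival y j x))); last by move=> j _; rewrite opprB -sum_survivalS.
  rewrite sumrN telescope_sumr // opprB; congr (_ - _).
  rewrite -mu_inv.1.2; apply: eq_bigr => x _.
  by rewrite /survival big_geq // subr0 mulr1.
have u0 : u @ \oo --> (0 : R).
  apply: cvg_series_cvg_0; apply: nondecreasing_is_cvgn.
    by apply/nondecreasing_seqP => n; rewrite /series /= big_nat_recr //= lerDl.
  exists 1 => _ [n _ <-]; rewrite uE gerBl sumr_ge0 // => x _.
  by rewrite mulr_ge0 ?survival_ge0 // ltW.
(* Dividing by [mu y > 0] recovers [survival y n y], and 1 minus it is the partial sum of the
   first-return probabilities. *)
have s0 : (fun n => 1 - (mu y)^-1 * u n) @ \oo --> (1 - (mu y)^-1 * 0).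
  by apply: cvgB; [exact: cvg_cst | apply: cvgMr].
rewrite mulr0 subr0 in s0; apply: cvg_trans s0; apply: near_eq_cvg.
apply: nearW => n; rewrite /u mulKf ?gt_eqF // /survival /series /=.
by rewrite opprB addrC subrK.
Qed.

End Recurrence.
End FiniteChains.

(** * Tensor powers of 2x2 matrices, indexed by subsets *)

Section TensorKernels.
Context {R : realType} {I : finType}.
Implicit Types (k l : bool -> bool -> R) (X Y Z : {set I}).

Definition tensor k X Y : R := \prod_i k (i \in X) (i \in Y).

Definition bool_comp k l : bool -> bool -> R :=
  fun a c => k a true * l true c + k a false * l false c.

(** Expand a product of two-term sums: choosing the [true] term at [i] means putting [i] in [Y]. *)
Lemma tensor_comp k l X Z :
  \sum_Y tensor k X Y * tensor l Y Z = tensor (bool_comp k l) X Z.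
Proof.
rewrite /tensor /bool_comp bigA_distr; apply: eq_bigr => Y _.
by rewrite -big_split; apply: eq_bigr => i _ /=; case: (i \in Y).
Qed.

Lemma eq_tensor k l : k =2 l -> tensor k =2 tensor l.
Proof. by move=> kl X Y; apply: eq_bigr => i _; rewrite kl. Qed.

Lemma mul_tensor_mx k l :
  kernel_mx (tensor k) *m kernel_mx (tensor l) = kernel_mx (tensor (bool_comp k l)).
Proof. by rewrite mul_kernel_mx; apply/eq_kernel_mx/tensor_comp. Qed.

Lemma tensor_id X Y : tensor (fun a b => (a == b)%:R) X Y = (X == Y)%:R.
Proof.
case: eqVneq => [->|neqXY]; first by apply: big1 => i _; rewrite eqxx.
apply/eqP/prodf_eq0; apply/exists_inP; apply: contraNT neqXY.
rewrite negb_exists_in => /forall_inP h; apply/eqP/setP => i.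
by have := h i isT; case: (i \in X); case: (i \in Y); rewrite /= ?eqxx.
Qed.

Lemma tensor_scale k x X Y :
  tensor (fun a b => k a b * (if b then x else 1)) X Y = tensor k X Y * x ^+ #|Y|.
Proof. by rewrite /tensor big_split /= -big_mkcond prodr_const. Qed.

Lemma tensor_gt0 k X Y : (forall a b, 0 < k a b) -> 0 < tensor k X Y.
Proof. by move=> k_gt0; apply: prodr_gt0. Qed.

End TensorKernels.

(** * Spectrum of the two walks *)

Section ComplementWalk.
Context {R : realType} {m : nat} {p : R}.
Hypotheses (p_gt0 : 0 < p) (p_lt1 : p < 1).
Implicit Types X Y Z : {set 'I_m}.

(** [true] means membership: an absent element surely enters, a present one leaves exactly when the
    down-step retains it. *)
Definition bit_walk (a b : bool) : R :=
  if a then (if b then 1 - p else p) else (if b then 1 else 0).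

Lemma complement_walk_probE X Z :
  complement_walk_prob p X Z = down_prob p X (~: Z).
Proof.
rewrite /complement_walk_prob (big_pred1 (~: Z)) // => Y.
by rewrite (can2_eq (@finset.setCK _) (@finset.setCK _)).
Qed.

Lemma complement_walk_prob_tensor X Z :
  complement_walk_prob p X Z = tensor bit_walk X Z.
Proof.
rewrite complement_walk_probE /down_prob /tensor; case: ifPn => [/fintype.subsetP sZX|].
  rewrite big_mkcond; apply: eq_bigr => i _.
  have := sZX i; rewrite finset.in_setC /bit_walk.
  by case: (i \in X); case: (i \in Z) => // /(_ isT).
case/subsetPn => i; rewrite finset.in_setC => /negbTE iZ /negbTE iX.
by rewrite (bigD1 i) //= iX iZ mul0r.
Qed.

Lemma complement_walkE :
  complement_walk p = kernel_mx (tensor bit_walk) :> 'M[R]_#|{set 'I_m}|.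
Proof. exact/eq_kernel_mx/complement_walk_prob_tensor. Qed.

Lemma complement_walk_sqr :
  complement_walk p ^+ 2 = down_up_walk p :> 'M[R]_#|{set 'I_m}|.
Proof.
rewrite expr2 [LHS]mul_kernel_mx [RHS]mul_kernel_mx; apply: eq_kernel_mx => X Z.
(* With the intermediate state written as [~: Y], the first step is a down-step to [Y] and the
   second is by definition the up-step from [Y]. *)
rewrite (reindex_inj (@finset.setC_inj 'I_m)) /=; apply: eq_bigr => Y _.
by rewrite complement_walk_probE finset.setCK.
Qed.

(* The columns (1,1) and (1,-p) are eigenvectors of [bit_walk] for the
   eigenvalues 1 and -p; [bit_dual] is the inverse matrix. *)
Definition bit_eig (a s : bool) : R := if s then (if a then - p else 1) else 1.

Definition bit_dual (s a : bool) : R :=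
  (if s then (if a then -1 else 1) else (if a then 1 else p)) / (1 + p).

Lemma eig_dual :
  kernel_mx (tensor bit_eig) *m kernel_mx (tensor bit_dual)
  = 1%:M :> 'M[R]_#|{set 'I_m}|.
Proof.
rewrite mul_tensor_mx -kernel_mx_id; apply: eq_kernel_mx => X Y.
rewrite -tensor_id; apply: eq_tensor => a b.
have p1 : 1 + p != 0 by rewrite gt_eqF // addr_gt0.
by case: a; case: b; rewrite /bool_comp /bit_eig /bit_dual /=; field.
Qed.

(** The column indexed by [Y] uses the eigenvector for [- p] exactly at the coordinates in [Y], each
    of which contributes one factor [- p]. *)
Lemma complement_walk_eig (V := kernel_mx (tensor bit_eig) : 'M[R]_#|{set 'I_m}|) :
  complement_walk p *m V =
  V *m diag_mx (\row_(i < #|{set 'I_m}|) (- p) ^+ #|enum_val i|).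
Proof.
rewrite complement_walkE mul_tensor_mx mul_mx_diag; apply/matrixP => i j.
rewrite !mxE -tensor_scale; apply: eq_tensor => a s.
by case: a; case: s; rewrite /bool_comp /bit_eig /bit_walk /=; ring.
Qed.

Lemma card_sets_of_size e :
  #|[pred i : 'I_#|{set 'I_m}| | #|enum_val i| == e]| = 'C(m, e).
Proof.
transitivity #|[set enum_rank A | A in [set A : {set 'I_m} | #|A| == e]%SET]%SET|; last first.
  by rewrite (card_imset _ enum_rank_inj) card_draws card_ord.
apply: eq_card => i.
have [A iA] : exists A, i = enum_rank A by exists (enum_val i); rewrite enum_valK.
by subst i; rewrite inE enum_rankK (mem_imset _ _ enum_rank_inj) finset.inE.
Qed.

Lemma eigenvalues_of_tensor_eig (A : 'M[R]_#|{set 'I_m}|) (lam : nat -> R)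
    (V := kernel_mx (tensor bit_eig) : 'M[R]_#|{set 'I_m}|) :
    A *m V = V *m diag_mx (\row_(i < #|{set 'I_m}|) lam #|enum_val i|) ->
    {in [pred e | (e <= m)%N] &, injective lam} ->
  eigenvalues_with_mult A m lam (fun e => 'C(m, e)).
Proof.
move=> AV lamI; apply: (eigenvalues_with_mult_conj_diag eig_dual AV) => //.
- by move=> i; rewrite -[leqRHS]card_ord max_card.
- by move=> e _; apply: card_sets_of_size.
- by move=> e em; rewrite bin_gt0.
Qed.

Lemma exprn_inj_lt1 : injective (GRing.exp p).
Proof.
move=> e f /eqP; rewrite eq_le !ler_iXn2l // => h.
by apply/eqP; rewrite eqn_leq andbC.
Qed.

Lemma eigenvalues_complement_walk :
  eigenvalues_with_mult (complement_walk p : 'M[R]_#|{set 'I_m}|) m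
    (fun e => (- p) ^+ e) (fun e => 'C(m, e)).
Proof.
apply: eigenvalues_of_tensor_eig complement_walk_eig _ => e f _ _.
(* The absolute value removes the sign and leaves distinct powers of [p]. *)
by move/(congr1 Num.norm); rewrite !normrX normrN gtr0_norm // => /exprn_inj_lt1.
Qed.

Lemma eigenvalues_down_up_walk :
  eigenvalues_with_mult (down_up_walk p : 'M[R]_#|{set 'I_m}|) m
    (fun e => p ^+ (2 * e)) (fun e => 'C(m, e)).
Proof.
apply: eigenvalues_of_tensor_eig => [|e f _ _ /exprn_inj_lt1 /eqP].
  rewrite -complement_walk_sqr expr2 -mulmxA complement_walk_eig mulmxA.
  rewrite complement_walk_eig -mulmxA mulmx_diag; congr (_ *m diag_mx _).
  by apply/rowP => i; rewrite !mxE -expr2 exprAC sqrrN -exprM.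
by rewrite eqn_pmul2l // => /eqP.
Qed.

(** * The invariant distribution *)

Lemma walk_piE X :
  walk_pi p X = \prod_i (if i \in X then (1 + p)^-1 else p / (1 + p)).
Proof.
rewrite (eq_bigr (fun i => (if i \in ~: X then p else 1) / (1 + p))); last first.
  by move=> i _; rewrite finset.in_setC; case: (i \in X); rewrite ?div1r.
rewrite big_split /= -big_mkcond !prodr_const card_ord /walk_pi exprVn.
by rewrite [#|~: X|]cardsCs finset.setCK card_ord.
Qed.

Lemma walk_pi_gt0 X : 0 < walk_pi p X.
Proof. by rewrite divr_gt0 ?exprn_gt0 ?addr_gt0. Qed.

Lemma walk_pi_distribution : distribution_on (walk_pi p : {set 'I_m} -> R).
Proof.
split=> [X|]; first exact/ltW/walk_pi_gt0.
rewrite (eq_bigr _ (fun X _ => walk_piE X)) -bigA_distr big1 //= => i _.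
by rewrite -{1}[(1 + p)^-1]mul1r -mulrDl divff // gt_eqF // addr_gt0.
Qed.

(** Balance holds in each coordinate: the flow between absent and present is [p / (1 + p)] both
    ways. *)
Lemma walk_pi_balance X Z :
  walk_pi p X * prob (complement_walk p) X Z =
  walk_pi p Z * prob (complement_walk p) Z X.
Proof.
rewrite !prob_kernel_mx !complement_walk_prob_tensor !walk_piE -!big_split.
apply: eq_bigr => i _; rewrite /bit_walk /=.
by case: (i \in X); case: (i \in Z) => /=; ring.
Qed.

Lemma complement_walk_sum1 X : \sum_Z prob (complement_walk p) X Z = 1.
Proof.
under eq_bigr => Z _ do rewrite prob_kernel_mx complement_walk_prob_tensor /tensor.
(* This form lets the sum over sets factor into row sums of [bit_walk]. *)
rewrite (eq_bigr (fun Z => \prod_i (if i \in Z then bit_walk (i \in X) true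
  else bit_walk (i \in X) false))); last first.
  by move=> Z _; apply: eq_bigr => i _; case: (i \in Z).
rewrite -bigA_distr big1 //= => i _.
by case: (i \in X); rewrite /bit_walk /= ?addr0 ?subrK.
Qed.

Lemma complement_walk_ge0 X Z : 0 <= prob (complement_walk p) X Z.
Proof.
rewrite prob_kernel_mx complement_walk_prob_tensor prodr_ge0 // => i _.
by case: (i \in X); case: (i \in Z); rewrite /bit_walk /= ?lexx ?ler01 ?subr_ge0 ?ltW.
Qed.

Lemma walk_pi_invariant :
  invariant_distribution (complement_walk p) (walk_pi p : {set 'I_m} -> R).
Proof.
split=> [|Z]; first exact: walk_pi_distribution.
under eq_bigr => X _ do rewrite walk_pi_balance.
by rewrite -mulr_sumr complement_walk_sum1 mulr1.
Qed.

Lemma complement_walk_unique :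
  unique_invariant_distribution (complement_walk p) (walk_pi p : {set 'I_m} -> R).
Proof.
apply: unique_invariant_distribution_rank1; first exact: walk_pi_invariant.
(* The case [e = 0] is the eigenvalue 1, of geometric multiplicity ['C(m, 0) = 1]. *)
by have [_ _ /(_ 0%N isT)] := eigenvalues_complement_walk; rewrite expr0 bin0.
Qed.

Lemma down_up_walk_unique :
  unique_invariant_distribution (down_up_walk p) (walk_pi p : {set 'I_m} -> R).
Proof.
apply: unique_invariant_distribution_rank1; last first.
  by have [_ _ /(_ 0%N isT)] := eigenvalues_down_up_walk; rewrite muln0 expr0 bin0.
have /invariant_distributionP[dpi inv] := walk_pi_invariant.
apply/invariant_distributionP; split=> //.
by rewrite -complement_walk_sqr expr2 mulmxA !inv.
Qed.

(** * Irreducibility and aperiodicity *)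

Let simp := (mul1r, mulr1, mul0r, mulr0, addr0, add0r).

(** The zero entry of [bit_walk] disappears in its square, whose rows are [(p, 1 - p)] and
    [(p (1 - p), p + (1 - p)^2)]. *)
Lemma complement_walk2_gt0 X Z : 0 < prob (complement_walk p ^+ 2) X Z.
Proof.
rewrite complement_walkE expr2 [X in prob X]mul_tensor_mx prob_kernel_mx.
by apply: tensor_gt0 => -[] []; rewrite /bool_comp /bit_walk /= ?simp;
  do ?[rewrite subr_gt0 | apply: addr_gt0 | apply: mulr_gt0].
Qed.

Lemma complement_walk3_gt0 X Z : 0 < prob (complement_walk p ^+ 3) X Z.
Proof.
rewrite complement_walkE exprS expr2 -!mulmxE !mul_tensor_mx prob_kernel_mx.
by apply: tensor_gt0 => -[] []; rewrite /bool_comp /bit_walk /= ?simp;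
  do ?[rewrite subr_gt0 | apply: addr_gt0 | apply: mulr_gt0].
Qed.

Lemma complement_walk_irreducible :
  irreducible_chain (complement_walk p : 'M[R]_#|{set 'I_m}|).
Proof. by move=> X Z; exists 2; apply: complement_walk2_gt0. Qed.

Lemma complement_walk_aperiodic :
  aperiodic (complement_walk p : 'M[R]_#|{set 'I_m}|).
Proof.
move=> X d dvd_return.
have d2 := dvd_return 2%N isT (complement_walk2_gt0 X X).
have d3 := dvd_return 3%N isT (complement_walk3_gt0 X X).
(* As [3 = 2 + 1], a common divisor of 2 and 3 divides 1. *)
by apply/eqP; rewrite -dvdn1 -(dvdn_addr 1 d2).
Qed.

End ComplementWalk.

Theorem corollary1p10 (R : realType) (m : nat) (p : R)
    (hm : (1 <= m)%N) (hp0 : 0 < p) (hp1 : p < 1) :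
  let P : 'M[R]_#|{set 'I_m}| := complement_walk p in
  let Q : 'M[R]_#|{set 'I_m}| := down_up_walk p in
  [/\ irreducible_chain P, reversible P, recurrent P, ergodic P
    & unique_invariant_distribution P (walk_pi p) /\
      eigenvalues_with_mult P m (fun e => (- p) ^+ e) (fun e => 'C(m, e))]
  /\
  [/\ P ^+ 2 = Q,
      unique_invariant_distribution Q (walk_pi p)
    & eigenvalues_with_mult Q m (fun e => p ^+ (2 * e)) (fun e => 'C(m, e))].
Proof.
move=> P Q; have irrP := complement_walk_irreducible hp0 hp1 : irreducible_chain P.
split; split=> //.
- exists (walk_pi p); [exact: walk_pi_invariant | exact: walk_pi_balance].
- apply: recurrent_of_invariant (walk_pi_invariant hp0) (walk_pi_gt0 hp0).
    exact: complement_walk_ge0.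
  exact: complement_walk_sum1.
- by split=> //; apply: complement_walk_aperiodic.
- by split; [apply: complement_walk_unique | apply: eigenvalues_complement_walk].
- exact: complement_walk_sqr.
- exact: down_up_walk_unique.
- exact: eigenvalues_down_up_walk.
Qed.
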